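(* Let $\alpha\in(0,1)$ and $A\in L(H)$. Suppose that for all $\rho>1$ the operator $\tau(1-\tau^{-1})^\alpha-A$ is invertible in $\ell_{2,\rho}(\mathbb{Z};H)$ with causal inverse. If for all $x\in H$ the mapping $$\{z\in\mathbb{C}:|z|>1\}\to H,\qquad z\mapsto\sum_{k=-\infty}^\infty\big[(\tau(1-\tau^{-1})^\alpha-A)^{-1}\delta_{-1}x\big]_k\,z^{-k}$$ has a continuous continuation to the unit circle $S_1$ (i.e. extends to a continuous map on $\{z\in\mathbb{C}:|z|\ge1\}$), then the zero equilibrium of the Riemann-Liouville equation $$\tau(1-\tau^{-1})^\alpha u=Au+\delta_{-1}x$$ and also that of the Caputo equation $$\tau(1-\tau^{-1})^\alpha u=Au+(1-\tau^{-1})^\alpha\chi_{\mathbb{Z}_{\ge-1}}x$$ is asymptotically stable.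
   Context: $H$ is a complex separable Hilbert space, $L(H)$ the bounded linear operators on $H$, $\mathbb{N}=\{0,1,2,\dots\}$. For $\rho>0$, $S_\rho=\{z\in\mathbb{C}:|z|=\rho\}$ and $\ell_{2,\rho}(\mathbb{Z};H)=\{x\in H^{\mathbb{Z}} : \sum_{k\in\mathbb{Z}}\|x_k\|_H^2\rho^{-2k}<\infty\}$, a Hilbert space with norm $(\sum_k\|x_k\|_H^2\rho^{-2k})^{1/2}$. $\tau$ is the shift $(\tau x)_k=x_{k+1}$, a bounded invertible operator on $\ell_{2,\rho}(\mathbb{Z};H)$. The operator $A\in L(H)$ also denotes the bounded operator $(x_k)_k\mapsto(Ax_k)_k$ on $\ell_{2,\rho}(\mathbb{Z};H)$. ''Invertible'' means bijective with bounded inverse. When the inverses are causal for all $\rho>1$, the sequence $(\tau(1-\tau^{-1})^\alpha-A)^{-1}\delta_{-1}x$ does not depend on the choice of $\rho>1$. For $u\in H^{\mathbb{Z}}$, $\operatorname{spt}u=\{n\in\mathbb{Z}:u_n\ne0\}$. For $x\in H$, $n\in\mathbb{Z}$, $\delta_nx\in H^{\mathbb{Z}}$ is the sequence with value $x$ at index $n$ and $0$ elsewhere, and $\chi_{\mathbb{Z}_{\ge n}}x$ is the sequence with value $x$ at all indices $m\ge n$ and $0$ for $m<n$. A linear operator $B$ on $\ell_{2,\rho}(\mathbb{Z};H)$ is causal if for all $a\in\mathbb{Z}$ and $g\in\ell_{2,\rho}(\mathbb{Z};H)$: $\operatorname{spt}g\subseteq\mathbb{Z}_{\ge a}$ implies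 $\operatorname{spt}Bg\subseteq\mathbb{Z}_{\ge a}$. For $|w|<1$ and $\alpha\in\mathbb{C}$, $(1+w)^\alpha:=\sum_{k=0}^\infty\binom{\alpha}{k}w^k$, where $\binom{\alpha}{0}=1$, $\binom{\alpha}{k}=\frac{\alpha(\alpha-1)\cdots(\alpha-k+1)}{k!}$. For $\rho>1$, the operator $(1-\tau^{-1})^\alpha$ on $\ell_{2,\rho}(\mathbb{Z};H)$ is defined as $\mathcal{Z}_\rho^*\,(1-z^{-1})^\alpha\,\mathcal{Z}_\rho$ (multiplication by $(1-z^{-1})^\alpha$ in the middle), where $\mathcal{Z}_\rho:\ell_{2,\rho}(\mathbb{Z};H)\to L_2(S_\rho;H)$ is the unitary transform $x\mapsto(z\mapsto\sum_k x_kz^{-k})$ (the series converging in $L_2(S_\rho;H)$, whose norm is $(\frac1{2\pi}\int_{S_\rho}\|f(z)\|_H^2\frac{|dz|}{|z|})^{1/2}$); equivalently, $((1-\tau^{-1})^\alpha u)_n=\sum_{k=0}^\infty(-1)^k\binom{\alpha}{k}u_{n-k}$ for $n\in\mathbb{Z}$. Asymptotic stability: the zero equilibrium (the solution $u=0$ for initial value $x=0$) of the Riemann-Liouville equation, respectively of the Caputo equation, is asymptotically stable if for every $\rho>1$, every solution $u\in\ell_{2,\rho}(\mathbb{Z};H)$ of that equation (for any initial value $x\in H$) with $\operatorname{spt}u\subseteq\mathbb{N}$ satisfies $\lim_{n\to\infty}u_n=0$ in $H$. *)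

(* Defs.v *)
From HB Require Import structures.
From mathcomp Require Import all_boot all_order all_algebra.
From mathcomp Require Import complex.
From mathcomp Require Import all_classical all_reals all_analysis.

Set Implicit Arguments.
Unset Strict Implicit.
Unset Printing Implicit Defensive.
Import Order.TTheory GRing.Theory Num.Theory.
Import numFieldNormedType.Exports.
Local Open Scope classical_set_scope.
Local Open Scope ring_scope.
Local Open Scope complex_scope.

(* A complex Hilbert space is a [completeNormedModType R[i]] whose norm comes
   from a positive definite form, conjugate-linear in its second argument. *)
Definition hilbert_norm (R : realType) (H : completeNormedModType R[i])
    (dot : {dot H for @Num.conj R[i]}) : Prop :=
  forall x : H, `|x| ^+ 2 = dot x x.

Definition separable (T : topologicalType) : Prop :=
  exists2 D : set T, countable D & dense D.

(* The norm of an [R[i]]-normed module has (nonnegative real) values in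
   [R[i]]; [rnorm] is the same norm with values in [R]. *)
Definition rnorm (R : realType) (H : normedModType R[i]) (x : H) : R :=
  complex.Re `|x|.

Definition bounded_op (R : realType) (H : normedModType R[i])
    (A : H -> H) : Prop :=
  exists M : R, forall x, rnorm (A x) <= M * rnorm x.

Section Sequences.
Context (R : realType) (H : completeNormedModType R[i]).
Implicit Types (u g : int -> H) (x : H) (rho : R) (a : R[i]).

Definition spt u : set int := [set n | u n != 0].

Definition delta (n : int) x : int -> H := fun m => if m == n then x else 0.

Definition chi_ge (n : int) x : int -> H := fun m => if n <= m then x else 0.

Definition tau u : int -> H := fun k => u (k + 1).

(* squared norm of [u] in l_{2,rho}, possibly +oo *)
Definition l2sq rho u : \bar R :=
  (\esum_(k in [set: int]) (rnorm (u k) ^+ 2 * rho ^ (- (2 * k)))%:E)%E.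

Definition l2 rho : set (int -> H) := [set u | (l2sq rho u < +oo)%E].

Definition l2norm rho u : R := Num.sqrt (fine (l2sq rho u)).

(* generalized binomial coefficient *)
Definition gbinom a (k : nat) : R[i] :=
  (\prod_(i < k) (a - i%:R)) / (k`!)%:R.

(* (1 - tau^-1)^a: the Z-transform turns multiplication by
   (1 - z^-1)^a = \sum_k (-1)^k binom(a, k) z^-k into convolution with the
   coefficients. For u in l_{2,rho} with rho > 1, the series converge
   absolutely. *)
Definition fdiff a u : int -> H :=
  fun n => limn (series (fun k : nat =>
    ((-1) ^+ k * gbinom a k) *: u (n - k%:Z))).

(* the operator tau (1 - tau^-1)^a - A *)
Definition frac_op a (A : H -> H) u : int -> H :=
  fun n => tau (fdiff a u) n - A (u n).

(* the inverse of [T] as a map of l_{2,rho} (meaningful when [T] is bijective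
   on l_{2,rho}) *)
Definition l2inv rho (T : (int -> H) -> (int -> H)) :
    (int -> H) -> (int -> H) :=
  'pinv_(fun=> fun=> 0) (l2 rho) T.

Definition l2_invertible rho (T : (int -> H) -> (int -> H)) : Prop :=
  set_bij (l2 rho) (l2 rho) T /\
  exists M : R, forall g, l2 rho g ->
    l2norm rho (l2inv rho T g) <= M * l2norm rho g.

Definition causal rho (B : (int -> H) -> (int -> H)) : Prop :=
  forall (n : int) g, l2 rho g ->
    spt g `<=` [set m | n <= m] -> spt (B g) `<=` [set m | n <= m].

(* \sum_(k in Z) u_k z^-k, as the sum of the series over k >= 0 and of the
   series over k < 0; [Negz k] is -(k+1). *)
Definition ztransform u (z : R[i]) : H :=
  limn (series (fun k : nat => z ^ (- Posz k) *: u (Posz k))) +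
  limn (series (fun k : nat => z ^ (- Negz k) *: u (Negz k))).

(* The map f, of which only the values on |z| > 1 matter, has a continuous
   extension to |z| >= 1; [R[i]^o] is [R[i]] with the topology of its norm. *)
Definition continuation_to_circle (f : R[i] -> H) : Prop :=
  exists F : R[i]^o -> H,
    {within [set z : R[i]^o | 1 <= `|z|], continuous F} /\
    forall z : R[i], 1 < `|z| -> F z = f z.

Definition RL_solution a (A : H -> H) x u : Prop :=
  tau (fdiff a u) = (fun n => A (u n) + delta (-1) x n).

Definition Caputo_solution a (A : H -> H) x u : Prop :=
  tau (fdiff a u) = (fun n => A (u n) + fdiff a (chi_ge (-1) x) n).

Definition asymptotically_stable (sol : H -> (int -> H) -> Prop) : Prop :=
  forall rho, 1 < rho -> forall x u, l2 rho u ->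
    spt u `<=` [set n | 0 <= n] -> sol x u ->
    (fun n : nat => u n%:Z) @ \oo --> (0 : H).

End Sequences.

(* Main.v *)
Require Import Defs.
From HB Require Import structures.
From mathcomp Require Import all_boot all_order all_algebra.
From mathcomp Require Import cyclic.
From mathcomp Require separable cyclotomic.
From mathcomp Require Import complex.
From mathcomp Require Import all_classical all_reals all_analysis.
From mathcomp Require Import ring lra zify.
Import Order.TTheory GRing.Theory Num.Theory.
Import numFieldNormedType.Exports.
Set Implicit Arguments.
Unset Strict Implicit.
Unset Printing Implicit Defensive.
Local Open Scope classical_set_scope.
Local Open Scope ring_scope.
Local Open Scope complex_scope.

(** Read on the indices [n >= 0], both equations are recurrences that determine
    their solution from [x]. For the Riemann-Liouville equation with solution
    [v] this makes [v] independent of the weight, hence of growth at most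
    [rho ^ n] for every [rho > 1], and identifies its Z-transform [F] on
    [|z| > 1] with the function that extends continuously to the circle. By
    compactness [|F| <= M] on [1 <= |z| <= 2].

    The boundedness of [F] is used only through [multiplier_bound]: multiplying
    the Z-transform of a scalar sequence [g] by [F] and comparing means of
    squares over [|z| = r], Parseval's identity and [r -> 1] show that the
    convolution [g * v] satisfies [|g * v|_2 <= M |g|_2], already for the
    partial sums of both sides. Means over the [N]-th roots of unity replace
    integrals over the circle: for polynomials of degree less than [N] they
    give Parseval's identity exactly, and on a circle [|z| = r > 1] the
    function [F] is a uniform limit of polynomials in [1/z].

    Taking for [g] the unit sequence gives that [v] is square summable, so
    [v] tends to [0].

    The solution of the Caputo equation is [u = d * v], where [d] is the
    coefficient sequence of [(1 - w)^(alpha - 1)]. Since [d] is not square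
    summable in general, it is split as [d = e * e] with [e] the coefficient
    sequence of [(1 - w)^((alpha - 1)/2)], which is square summable because its
    entries decay like [k^(-(1 + alpha)/2)] ([pow1B_square_sum]). Then [e * v]
    is square summable by the multiplier bound, and [u = e * (e * v)], as the
    convolution of two square summable sequences, tends to [0]. *)

(** * Convolution of sequences *)

Lemma sum_triangle (V : nmodType) (F : nat -> nat -> V) n :
  \sum_(0 <= m < n) \sum_(0 <= i < m.+1) F i m =
  \sum_(0 <= i < n) \sum_(0 <= j < n - i) F i (i + j)%N.
Proof.
elim: n => [|n IHn]; first by rewrite !big_nil.
rewrite big_nat_recr //= IHn [RHS]big_nat_recr //= subSnn big_nat1 addn0.
rewrite [X in _ + X]big_nat_recr //= addrA; congr (_ + _).
rewrite -big_split; apply: eq_big_nat => i /andP[_ /ltnW le_in].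
by rewrite subSn // [RHS]big_nat_recr //= subnKC.
Qed.

Definition conv {K : pzRingType} {V : lmodType K} (a : nat -> K)
    (u : nat -> V) (n : nat) : V :=
  \sum_(0 <= i < n.+1) a i *: u (n - i)%N.

Section Convolution.
Context {K : comPzRingType} {V : lmodType K}.
Implicit Types (a b : nat -> K) (u : nat -> V).

Lemma conv_assoc a b u :
  conv a (conv b u) = conv (conv (V := K^o) a b) u.
Proof.
apply/funext => n; rewrite /conv.
under [RHS]eq_bigr do rewrite scaler_suml.
rewrite (sum_triangle (fun i m => (a i * b (m - i)%N) *: u (n - m)%N)).
apply: eq_big_nat => i /andP[_ le_in]; rewrite scaler_sumr subSn //.
apply: eq_big_nat => j _; rewrite addKn subnDA scalerA //.
Qed.

Lemma convC a b : conv (V := K^o) a b = conv (V := K^o) b a.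
Proof.
apply/funext => n; rewrite /conv big_nat_rev /=.
apply: eq_big_nat => i /andP[_ le_in].
by rewrite add0n subSS subKn // [_ *: _]mulrC.
Qed.

End Convolution.

Lemma conv_delta (K : pzRingType) (V : lmodType K) (v : nat -> V) :
  conv (fun k => (k == 0)%:R) v = v.
Proof.
apply/funext => n; rewrite /conv big_nat_recl //= scale1r subn0.
by rewrite big1 ?addr0 // => i _; rewrite scale0r.
Qed.

(** The causal equations have a leading coefficient [c 0 = 1], so each value is
    determined by the previous ones. *)
Lemma conv_recurrence_uniq (K : pzRingType) (V : lmodType K) (c : nat -> K)
    (A : V -> V) (u v : nat -> V) :
  c 0 = 1 -> conv c u 0 = conv c v 0 ->
  (forall n, conv c u n.+1 - A (u n) = conv c v n.+1 - A (v n)) -> u = v.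
Proof.
move=> c0 uv0 uvS; apply/funext => n; elim/ltn_ind: n => -[_|n IHn].
  by move: uv0; rewrite /conv !big_nat1 c0 !scale1r.
have := uvS n; rewrite (IHn n) // => /addIr.
rewrite /conv !(big_nat_recl n.+1) //= c0 !scale1r subn0.
rewrite (eq_big_nat _ _ (F2 := fun i => c i.+1 *: v (n.+1 - i.+1)%N)).
  exact: addIr.
by move=> i /andP[_ le_in]; rewrite IHn // subSS ltnS leq_subr.
Qed.

Definition trunc {V : nmodType} (p : nat) (s : nat -> V) (k : nat) : V :=
  if (k < p)%N then s k else 0.

Lemma sum_trunc (V W : nmodType) p q (s : nat -> V) (h : nat -> V -> W) :
  (p <= q)%N -> (forall i, h i 0 = 0) ->
  \sum_(0 <= i < q) h i (trunc p s i) = \sum_(0 <= i < p) h i (s i).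
Proof.
move=> le_pq h0; rewrite (big_cat_nat (leq0n p) le_pq) //= [X in _ + X]big_nat.
rewrite [X in _ + X]big1 ?addr0.
  by apply: eq_big_nat => i /andP[_ lt_ip]; rewrite /trunc lt_ip.
by move=> i /andP[le_pi _]; rewrite /trunc ltnNge le_pi h0.
Qed.

Lemma mul_truncated_series (K : comPzRingType) (V : lmodType K) (g : nat -> K)
    (v : nat -> V) (z : K) m n :
  (\sum_(0 <= i < m) z ^+ i * g i) *: (\sum_(0 <= j < n) z ^+ j *: v j) =
  \sum_(0 <= k < m + n) z ^+ k *: conv (trunc m g) (trunc n v) k.
Proof.
rewrite /conv; under [RHS]eq_bigr do rewrite scaler_sumr.
rewrite (sum_triangle
  (fun i k => z ^+ k *: (trunc m g i *: trunc n v (k - i)%N))).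
transitivity (\sum_(0 <= i < m) \sum_(0 <= j < n) z ^+ (i + j) *: (g i *: v j)).
  rewrite scaler_suml; apply: eq_bigr => i _.
  rewrite scaler_sumr; apply: eq_bigr => j _.
  by rewrite !scalerA exprD; congr (_ *: _); ring.
have /= -> := sum_trunc g (h := fun i b => \sum_(0 <= j < m + n - i)
  z ^+ (i + j) *: (b *: trunc n v (i + j - i)%N)) (leq_addr n m); last first.
  by move=> i; rewrite big1 // => j _; rewrite scale0r scaler0.
apply: eq_big_nat => i /andP[_ lt_im].
have le_n : (n <= m + n - i)%N.
  by rewrite leq_subRL ?(leq_trans (ltnW lt_im)) ?leq_addr // leq_add2r ltnW.
have /= <- := sum_trunc v (h := fun j y => z ^+ (i + j) *: (g i *: y)) le_n.
  by apply: eq_bigr => j _; rewrite addKn.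
by move=> j; rewrite !scaler0.
Qed.

(** * Coefficients of the powers of 1 - w *)

Section BinomialCoefficients.
Context {R : realType}.
Implicit Types a b : R[i].

(** The coefficient of [w ^ k] in [(1 - w)^a]. *)
Definition pow1B a k : R[i] := (-1) ^+ k * gbinom a k.

Lemma pow1B0 a : pow1B a 0 = 1.
Proof. by rewrite /pow1B /gbinom big_ord0 fact0 invr1 !mulr1 expr0. Qed.

Lemma pow1BS a k : k.+1%:R * pow1B a k.+1 = (k%:R - a) * pow1B a k.
Proof.
have k0 : k.+1%:R != 0 :> R[i] by rewrite pnatr_eq0.
have f0 : (k`!)%:R != 0 :> R[i] by rewrite pnatr_eq0 -lt0n fact_gt0.
rewrite /pow1B /gbinom big_ord_recr factS natrM exprS /=.
by field; rewrite f0 addrC natr1 k0.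
Qed.

(** This is [(1 - w)^a (1 - w)^b = (1 - w)^(a + b)]. Both sides obey the
    recurrence [pow1BS]: multiplying the [k+1]-st coefficient of the product by
    [k + 1 = i + (k + 1 - i)] lets it act on each factor. *)
Lemma pow1BD a b : conv (V := R[i]^o) (pow1B a) (pow1B b) = pow1B (a + b).
Proof.
apply/funext; elim=> [|k IHk].
  by rewrite /conv big_nat1 !pow1B0 [_ *: _]mulr1.
have k0 : k.+1%:R != 0 :> R[i] by rewrite pnatr_eq0.
have scE (x y : R[i]) : x *: (y : R[i]^o) = x * y by [].
apply: (mulfI k0); rewrite pow1BS -IHk {IHk} /conv !mulr_sumr.
transitivity (\sum_(0 <= i < k.+2) (i%:R * pow1B a i) * pow1B b (k.+1 - i) +
    \sum_(0 <= i < k.+2) pow1B a i * ((k.+1 - i)%:R * pow1B b (k.+1 - i))).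
  rewrite -big_split; apply: eq_big_nat => i /andP[_ lt_ik].
  by rewrite /= natrB // scE; ring.
rewrite big_nat_recl // mul0r mul0r add0r.
rewrite [X in _ + X]big_nat_recr // subnn /= mul0r mulr0 addr0.
rewrite -big_split; apply: eq_big_nat => i /andP[_ lt_ik].
rewrite /= subSS pow1BS subSn // pow1BS natrB // scE.
by ring.
Qed.

Lemma pow1BN1 k : pow1B (-1) k = 1.
Proof.
elim: k => [|k IHk]; first exact: pow1B0.
have k0 : k.+1%:R != 0 :> R[i] by rewrite pnatr_eq0.
by apply: (mulfI k0); rewrite pow1BS IHk opprK natr1.
Qed.

End BinomialCoefficients.

(** * Roots of unity and Parseval's identity *)

Lemma closed_prim_root_exists (K : closedFieldType) n :
  n%:R != 0 :> K -> exists w : K, n.-primitive_root w.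
Proof.
move=> n0.
have n_gt0 : (0 < n)%N by rewrite lt0n; apply: contraNneq n0 => ->.
have [rs] := closed_field_poly_normal ('X^n - 1 : {poly K}).
rewrite (monicP (monicXnsubC _ n_gt0)) scale1r => rsE.
have /hasP[w _ prim_w] : has n.-primitive_root rs; last by exists w.
apply: has_prim_root => //.
- by apply/allP => w; rewrite -root_prod_XsubC -rsE.
- by rewrite -separable.separable_prod_XsubC -rsE
    cyclotomic.separable_Xn_sub_1.
- by rewrite -ltnS -(size_prod_XsubC rs id) -rsE size_XnsubC.
Qed.

Lemma norm_unity_root (K : numDomainType) n (w : K) :
  n.-primitive_root w -> `|w| = 1.
Proof.
move=> prim_w; apply/eqP.
rewrite -(@pexpr_eq1 _ `|w| n) ?(prim_order_gt0 prim_w) //.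
by rewrite -normrX (prim_expr_order prim_w) normr1.
Qed.

Lemma prim_root_orthogonality (K : numClosedFieldType) n (w : K) (k l : 'I_n) :
  n.-primitive_root w ->
  \sum_(j < n) (w ^+ j) ^+ k * ((w ^+ j) ^+ l)^* = (k == l)%:R * n%:R.
Proof.
move=> prim_w; have w1 := norm_unity_root prim_w.
have w0 : w != 0 by rewrite -normr_eq0 w1 oner_eq0.
have ww : w * w^* = 1 by rewrite -normCK w1 expr1n.
pose z := w ^+ k * (w ^+ l)^*.
have zw : z * w ^+ l = w ^+ k.
  by rewrite -mulrA [_^* * _]mulrC rmorphXn -exprMn ww expr1n mulr1.
have -> : \sum_(j < n) (w ^+ j) ^+ k * ((w ^+ j) ^+ l)^* = \sum_(j < n) z ^+ j.
  by apply: eq_bigr => j _; rewrite exprMn -rmorphXn -!exprM !(mulnC j).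
have [kl|neq_kl] := eqVneq k l.
  have -> : z = 1 by rewrite /z kl rmorphXn -exprMn ww expr1n.
  by under eq_bigr do rewrite expr1n; rewrite sumr_const card_ord mul1r.
rewrite mul0r; apply/eqP.
have zn : z ^+ n = 1.
  rewrite exprMn -rmorphXn -!exprM !(mulnC _ n) !exprM (prim_expr_order prim_w).
  by rewrite !expr1n rmorph1 mulr1.
have z1 : z - 1 != 0.
  apply: contraNneq neq_kl => /subr0_eq z1; move: zw; rewrite z1 mul1r.
  move/eqP; rewrite (eq_prim_root_expr prim_w) !modn_small // => /eqP lk.
  by apply/eqP/val_inj.
by rewrite -(mulrI_eq0 _ (mulfI z1)) -subrX1 zn subrr.
Qed.

(** The form [f] stands for either the inner product of a Hilbert space or
    [x * y^*] on the scalars. *)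
Lemma parseval (K : numClosedFieldType) (V : lmodType K) (f : V -> V -> K)
    n (w : K) (a : 'I_n -> V) :
  (forall y, scalar (f^~ y)) ->
  (forall x, linear_for (Num.conj \; *%R) (f x)) ->
  n.-primitive_root w ->
  \sum_(j < n) (let x := \sum_(k < n) (w ^+ j) ^+ k *: a k in f x x) =
  n%:R * \sum_(k < n) f (a k) (a k).
Proof.
move=> fl fr prim_w.
(* Packing [f] as linear maps in each variable makes [linear_sum] apply. *)
pose Fl y := GRing.isLinear.Build K V K *%R (f^~ y) (fl y).
pose Gl y : {scalar V} := HB.pack (f^~ y) (Fl y).
pose Fr x := GRing.isLinear.Build K V K (Num.conj \; *%R) (f x) (fr x).
pose Gr x : {linear V -> K | Num.conj \; *%R} := HB.pack (f x) (Fr x).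
transitivity (\sum_(j < n) \sum_(k < n) \sum_(l < n)
   ((w ^+ j) ^+ k * ((w ^+ j) ^+ l)^*) * f (a k) (a l)).
  apply: eq_bigr => j _; set x := \sum_(k < n) _ *: _.
  rewrite /= -[f x x]/(Gl x x) {2}/x linear_sum /=; apply: eq_bigr => k _.
  rewrite -[LHS]/(Gl x (_ *: a k)) linearZ /= -[f _ _]/(Gr (a k) x) /x.
  rewrite linear_sum mulr_sumr; apply: eq_bigr => l _.
  by rewrite linearZ /= mulrA.
rewrite exchange_big /= mulr_sumr; apply: eq_bigr => k _.
rewrite exchange_big /= (bigD1 k) //= -mulr_suml prim_root_orthogonality //.
rewrite eqxx mul1r big1 ?addr0 // => l lk.
by rewrite -mulr_suml prim_root_orthogonality // eq_sym (negPf lk) !mul0r.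
Qed.

(** * Real-valued norms *)

Section RealNorm.
Context {R : realType} {V : normedModType R[i]}.
Implicit Types (x y : V) (a : R[i]).

Lemma rnormE x : `|x| = (rnorm x)%:C.
Proof. by rewrite /rnorm RRe_real // ger0_real. Qed.

Lemma rnorm_ge0 x : 0 <= rnorm x.
Proof. by rewrite -ler0c -rnormE. Qed.

Lemma rnorm0 : rnorm (0 : V) = 0.
Proof. by rewrite /rnorm normr0. Qed.

Lemma rnormN x : rnorm (- x) = rnorm x.
Proof. by rewrite /rnorm normrN. Qed.

Lemma ler_rnormD x y : rnorm (x + y) <= rnorm x + rnorm y.
Proof. by rewrite -lecR rmorphD /= -!rnormE ler_normD. Qed.

Lemma rnormZ a x : rnorm (a *: x) = rnorm (a : R[i]^o) * rnorm x.
Proof. by apply: complexI; rewrite rmorphM /= -!rnormE normrZ. Qed.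

Lemma ler_rnorm_sum n (F : nat -> V) :
  rnorm (\sum_(0 <= k < n) F k) <= \sum_(0 <= k < n) rnorm (F k).
Proof.
elim: n => [|n IHn]; first by rewrite !big_nil rnorm0.
rewrite !big_nat_recr //=; apply: (le_trans (ler_rnormD _ _)).
exact: lerD.
Qed.

End RealNorm.

Section ScalarNorm.
Context {R : realType}.
Implicit Types a b : R[i].

Lemma cnormM a b :
  rnorm (a * b : R[i]^o) = rnorm (a : R[i]^o) * rnorm (b : R[i]^o).
Proof. exact: rnormZ. Qed.

Lemma cnorm1 : rnorm (1 : R[i]^o) = 1.
Proof. by apply: complexI; rewrite -rnormE normr1. Qed.

Lemma cnormX a n : rnorm (a ^+ n : R[i]^o) = rnorm (a : R[i]^o) ^+ n.
Proof. by elim: n => [|n IHn]; rewrite ?cnorm1 // !exprS cnormM IHn. Qed.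

Lemma cnorm_real (r : R) : rnorm (r%:C : R[i]^o) = `|r|.
Proof.
apply: complexI; rewrite -rnormE.
by rewrite normc_def /= expr0n /= addr0 sqrtr_sqr.
Qed.

End ScalarNorm.

Lemma sum_delta_sq (R : realType) n :
  \sum_(0 <= k < n) rnorm ((k == 0)%:R : R[i]^o) ^+ 2 <= 1.
Proof.
case: n => [|n]; first by rewrite big_nil.
rewrite big_nat_recl //= cnorm1 expr1n big1 ?addr0 // => i _.
by rewrite rnorm0 expr0n.
Qed.

Lemma rnorm_continuous (R : realType) (V : normedModType R[i]) :
  continuous (@rnorm R V).
Proof.
move=> x; apply/cvgrPdist_le => e e_gt0.
have e0 : 0 < e%:C by rewrite (ltcR 0).
near=> y.
have xy : rnorm (x - y) <= e.
  rewrite -lecR -rnormE; near: y.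
  by move: e%:C e0; apply/cvgrPdist_le; exact: cvg_id.
have := ler_rnormD (x - y) y; rewrite subrK.
have := ler_rnormD (y - x) x; rewrite subrK -opprB rnormN.
by rewrite ler_norml; lra.
Unshelve. all: by end_near. Qed.

Lemma real_complex_continuous (R : realType) :
  continuous (real_complex R : R -> R[i]^o).
Proof.
move=> x; apply/cvgrPdist_le => e e_gt0.
have eE : e = (complex.Re e)%:C by rewrite RRe_real // gtr0_real.
have e0 : 0 < complex.Re e by rewrite -ltcR -eE.
near=> y; rewrite -rmorphB rnormE cnorm_real eE lecR; near: y.
by move: (complex.Re e) e0; apply/cvgrPdist_le; exact: cvg_id.
Unshelve. all: by end_near. Qed.

Lemma rnorm_cvg (R : realType) (V : normedModType R[i]) (u : nat -> V)
    (l : V) :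
  (forall e : R, 0 < e ->
     exists N, forall n, (N <= n)%N -> rnorm (l - u n) <= e) ->
  u @ \oo --> l.
Proof.
move=> ul; apply/cvgrPdist_le => e e_gt0.
have eE : e = (complex.Re e)%:C by rewrite RRe_real // gtr0_real.
have [|N uN] := ul (complex.Re e); first by rewrite -ltcR -eE.
exists N => // n /= le_Nn; rewrite eE rnormE lecR; exact: uN.
Qed.

Lemma cvg_rnorm (R : realType) (V : normedModType R[i]) (u : nat -> V)
    (l : V) :
  u @ \oo --> l ->
  forall e : R, 0 < e -> exists N, forall n, (N <= n)%N -> rnorm (l - u n) <= e.
Proof.
move=> /cvgrPdist_le ul e e_gt0.
have [|N _ uN] := ul e%:C; first by rewrite (ltcR 0).
by exists N => n /uN; rewrite rnormE lecR.
Qed.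

Lemma parseval_rnorm (R : realType) (V : normedModType R[i])
    (f : V -> V -> R[i]) n (w : R[i]) (a : nat -> V) :
  (forall y, scalar (f^~ y)) ->
  (forall x, linear_for (Num.conj \; *%R) (f x)) ->
  (forall x, `|x| ^+ 2 = f x x) ->
  n.-primitive_root w ->
  \sum_(0 <= j < n) rnorm (\sum_(0 <= k < n) (w ^+ j) ^+ k *: a k) ^+ 2 =
  n%:R * \sum_(0 <= k < n) rnorm (a k) ^+ 2.
Proof.
move=> fl fr fE prim_w; apply: complexI.
rewrite rmorphM rmorph_nat !rmorph_sum /= !big_mkord.
have := parseval (fun k : 'I_n => a k) fl fr prim_w.
under eq_bigr do rewrite /= -fE rnormE -rmorphXn.
under [in RHS]eq_bigr do rewrite -fE rnormE -rmorphXn.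
by move=> <-; apply: eq_bigr => j _; rewrite big_mkord.
Qed.

Lemma parseval_scalar (R : realType) n (w : R[i]) (a : nat -> R[i]) :
  n.-primitive_root w ->
  \sum_(0 <= j < n)
     rnorm (\sum_(0 <= k < n) (w ^+ j) ^+ k * a k : R[i]^o) ^+ 2 =
  n%:R * \sum_(0 <= k < n) rnorm (a k : R[i]^o) ^+ 2.
Proof.
apply: (@parseval_rnorm _ R[i]^o (fun x y => x * y^*)).
- by move=> y c x z; rewrite mulrDl -mulrA.
- by move=> x c y z /=; rewrite rmorphD rmorphM mulrDr mulrCA.
- by move=> x; rewrite normCK.
Qed.

(** * The multiplier bound *)

Lemma poly_ge0_at0 (R : realType) (p : {poly R}) :
  (forall t, 0 < t -> t <= 2^-1 -> 0 <= p.[t]) -> 0 <= p.[0].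
Proof.
move=> p_ge0.
have cp : horner p t @[t --> 0^'+] --> p.[0].
  by apply: cvg_at_right_filter; exact: continuous_horner.
rewrite -(cvg_lim _ cp) //; apply: limr_ge; first by apply/cvg_ex; exists p.[0].
near=> t; apply: p_ge0; near: t.
  exact: nbhs_right_gt.
by apply: nbhs_right_le.
Unshelve. all: by end_near. Qed.

(** Here [F] is a power series in [z], with [z] the inverse of the variable of
    the Z-transform. On the circle of radius [q < 1], replace [F] by a partial
    sum [S] with [|S| <= M + eps]. With [P] the polynomial of coefficients
    [g k], [k < K], the coefficients of [P * S] of degree less than [K] are
    those of [g * v], so averaging [|P S|^2 <= (M + eps)^2 |P|^2] over enough
    roots of unity gives the bound with weights [q ^ (2 k)]. Letting [q] tend
    to [1] and [eps] to [0] removes both. *)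
Lemma multiplier_bound (R : realType) (V : normedModType R[i])
    (f : V -> V -> R[i]) (F : R[i] -> V) (M : R) (v : nat -> V)
    (g : nat -> R[i]) K :
  (forall y, scalar (f^~ y)) ->
  (forall x, linear_for (Num.conj \; *%R) (f x)) ->
  (forall x, `|x| ^+ 2 = f x x) ->
  (forall q eps : R, 0 < q -> q < 1 -> 0 < eps ->
     exists n0, forall n, (n0 <= n)%N -> forall z : R[i],
       rnorm (z : R[i]^o) = q ->
       rnorm (F z - \sum_(0 <= k < n) z ^+ k *: v k) <= eps) ->
  (forall z : R[i], 2^-1 <= rnorm (z : R[i]^o) < 1 -> rnorm (F z) <= M) ->
  \sum_(0 <= k < K) rnorm (conv g v k) ^+ 2 <=
  M ^+ 2 * \sum_(0 <= k < K) rnorm (g k : R[i]^o) ^+ 2.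
Proof.
move=> fl fr fE Funif FM.
set G := \sum_(0 <= k < K) rnorm (g k : _^o) ^+ 2.
have circle q eps : 2^-1 <= q -> q < 1 -> 0 < eps ->
    \sum_(0 <= k < K) (q ^+ k) ^+ 2 * rnorm (conv g v k) ^+ 2 <=
    (M + eps) ^+ 2 * G.
  move=> q_ge q_lt1 eps_gt0.
  have q_gt0 : 0 < q by apply: lt_le_trans q_ge; rewrite invr_gt0.
  have [n0 Fn0] := Funif q eps q_gt0 q_lt1 eps_gt0.
  pose L := maxn n0 K.+1; pose N := (K + L)%N.
  have N_gt0 : 0 < N%:R :> R by rewrite ltr0n addn_gt0 leq_max ltn0Sn !orbT.
  have [w prim_w] : exists w : R[i], N.-primitive_root w.
    by apply: closed_prim_root_exists; rewrite pnatr_eq0 -lt0n -(ltr0n R).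
  have w1 : rnorm (w : R[i]^o) = 1.
    by apply: complexI; rewrite -rnormE (norm_unity_root prim_w).
  pose c := conv (trunc K g) (trunc L v).
  have cE k : (k < K)%N -> c k = conv g v k.
    move=> lt_kK; apply: eq_big_nat => i /andP[_ le_ik].
    rewrite /trunc (leq_ltn_trans _ lt_kK) // ifT //.
    rewrite (leq_ltn_trans (leq_subr _ _)) // (ltn_trans lt_kK) //.
    by rewrite leq_max ltnSn orbT.
  pose P z := \sum_(0 <= k < K) z ^+ k * g k.
  pose S z := \sum_(0 <= k < L) z ^+ k *: v k.
  pose z j := q%:C * w ^+ j.
  have zq j : rnorm (z j : R[i]^o) = q.
    by rewrite cnormM cnormX w1 expr1n mulr1 cnorm_real gtr0_norm.
  have SM j : rnorm (S (z j)) <= M + eps.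
    have -> : S (z j) = F (z j) - (F (z j) - S (z j)) by rewrite subKr.
    apply: (le_trans (ler_rnormD _ _)); rewrite rnormN lerD ?FM ?zq ?q_ge //.
    by apply: Fn0; rewrite ?zq ?leq_maxl.
  have qZ (W : normedModType R[i]) k (x : W) :
      rnorm ((q ^+ k)%:C *: x) ^+ 2 = (q ^+ k) ^+ 2 * rnorm x ^+ 2.
    by rewrite rnormZ exprMn cnorm_real real_normK ?num_real.
  have eqC : \sum_(0 <= j < N) rnorm (P (z j) *: S (z j)) ^+ 2 =
      N%:R * \sum_(0 <= k < N) (q ^+ k) ^+ 2 * rnorm (c k) ^+ 2.
    under [in RHS]eq_bigr do rewrite -qZ.
    rewrite -(parseval_rnorm _ fl fr fE prim_w); apply: eq_bigr => j _.
    rewrite mul_truncated_series; congr (rnorm _ ^+ _).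
    by apply: eq_bigr => k _; rewrite scalerA exprMn rmorphXn mulrC.
  have eqG : \sum_(0 <= j < N) rnorm (P (z j) : R[i]^o) ^+ 2 =
      N%:R * \sum_(0 <= k < K) (q ^+ k) ^+ 2 * rnorm (g k : R[i]^o) ^+ 2.
    have := parseval_scalar (fun k => (q ^+ k)%:C * trunc K g k) prim_w.
    rewrite [X in _ = _ * X -> _](eq_bigr _ (fun k _ => qZ R[i]^o k _)).
    rewrite (sum_trunc g
      (h := fun k x => (q ^+ k) ^+ 2 * rnorm (x : R[i]^o) ^+ 2)
      (leq_addr L K)); last first.
      by move=> k; rewrite rnorm0 expr0n mulr0.
    move=> <-; apply: eq_bigr => j _; congr (rnorm _ ^+ _).
    rewrite (sum_trunc g (h := fun k x => (w ^+ j) ^+ k * ((q ^+ k)%:C * x))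
      (leq_addr L K)); last first.
      by move=> k; rewrite !mulr0.
    by apply: eq_bigr => k _; rewrite mulrA exprMn rmorphXn [_ * _ ^+ _]mulrC.
  rewrite -(ler_pM2l N_gt0).
  apply: (@le_trans _ _
    (N%:R * \sum_(0 <= k < N) (q ^+ k) ^+ 2 * rnorm (c k) ^+ 2)).
    rewrite ler_pM2l // [leRHS](big_cat_nat (leq0n K) (leq_addr L K)) /=.
    rewrite [leLHS](_ : _ =
        \sum_(0 <= k < K) (q ^+ k) ^+ 2 * rnorm (c k) ^+ 2).
      by rewrite lerDl sumr_ge0 // => k _; rewrite mulr_ge0 ?sqr_ge0.
    by apply: eq_big_nat => k /andP[_ /cE ->].
  rewrite -eqC.
  apply: (@le_trans _ _ ((M + eps) ^+ 2 *
    (N%:R * \sum_(0 <= k < K) (q ^+ k) ^+ 2 * rnorm (g k : R[i]^o) ^+ 2))).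
    rewrite -eqG mulr_sumr; apply: ler_sum => j _.
    rewrite rnormZ exprMn mulrC ler_wpM2r ?sqr_ge0 //.
    rewrite ler_pXn2r ?nnegrE ?rnorm_ge0 //.
    exact: (le_trans (rnorm_ge0 _) (SM 0%N)).
  rewrite mulrCA ler_pM2l // ler_wpM2l ?sqr_ge0 //.
  apply: ler_sum => k _; rewrite ler_piMl ?sqr_ge0 //.
  by rewrite -exprM exprn_ile1 // ltW.
(* Both limits at once, along [eps = t] and [q = 1 - t] with [t -> 0]. *)
pose p : {poly R} := G *: (M%:P + 'X) ^+ 2 -
  \sum_(0 <= k < K) (rnorm (conv g v k) ^+ 2)%:P * ((1 - 'X) ^+ k) ^+ 2.
have pE t : p.[t] = (M + t) ^+ 2 * G -
    \sum_(0 <= k < K) ((1 - t) ^+ k) ^+ 2 * rnorm (conv g v k) ^+ 2.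
  rewrite /p hornerD hornerN hornerZ horner_exp hornerD hornerC hornerX.
  rewrite horner_sum mulrC.
  congr (_ - _).
  apply: eq_bigr => k _.
  by rewrite hornerM hornerC !horner_exp hornerD hornerN hornerX hornerC mulrC.
have : 0 <= p.[0].
  apply: poly_ge0_at0 => t t_gt0 t_le; rewrite pE subr_ge0.
  by apply: circle => //; lra.
rewrite pE subr_ge0 addr0 subr0; apply: le_trans.
by apply: ler_sum => k _; rewrite !expr1n mul1r.
Qed.

(** * Square summable sequences *)

(** For [0 < c < 1/2], write [e k] for the norm of the [k]-th coefficient of
    [(1 - w)^(-c)]. Heuristically [e k ^ 2] behaves like [k ^ (2 c - 2)], so
    [t k = (k + 1) * e k ^ 2] decreases at a rate comparable to [e k ^ 2]; the
    shift by [1] makes [(1 - 2 c) * e k ^ 2 <= t k - t (k + 1)] hold from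
    [k = 0] on, and the sum telescopes. *)
Lemma pow1B_square_sum (R : realType) (c : R) n : 0 < c -> c < 2^-1 ->
  (1 - 2 * c) * \sum_(0 <= k < n) rnorm (pow1B (- c)%:C k : R[i]^o) ^+ 2 <=
  1 - n.+1%:R * rnorm (pow1B (- c)%:C n : R[i]^o) ^+ 2.
Proof.
move=> c_gt0 c_lt.
elim: n => [|n IHn].
  by rewrite big_nil pow1B0 cnorm1 expr1n mulr0 mulr1 subrr.
rewrite big_nat_recr //= mulrDr.
set e := rnorm (pow1B _ n : R[i]^o) in IHn *.
set e' := rnorm (pow1B _ n.+1 : R[i]^o).
have ee' : n.+1%:R * e' = (n%:R + c) * e.
  have := congr1 (fun x : R[i] => rnorm (x : R[i]^o)) (pow1BS (- c)%:C n).
  rewrite /= cnormM (cnormM (_ - _)) -(rmorph_nat (real_complex R)).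
  rewrite -(rmorph_nat (real_complex R) n).
  rewrite -rmorphB /= !cnorm_real opprK ger0_norm // ger0_norm //.
  by rewrite addr_ge0 // ltW.
have n_ge0 : 0 <= n%:R :> R by [].
have -> : e' = (n%:R + c) / (n%:R + 1) * e.
  by rewrite mulrAC -ee' natr1 mulrAC mulfV ?mul1r // pnatr_eq0.
apply: (le_trans (lerD IHn (lexx _))).
rewrite -!natr1 in ee' *; set x : R := n%:R in n_ge0 *.
have x1 : 0 < x + 1 by lra.
suff H : 0 <= (x + 1) - (1 - 2 * c) - (x + 1 + 1) * ((x + c) / (x + 1)) ^+ 2.
  rewrite -subr_ge0; have := mulr_ge0 H (sqr_ge0 e).
  by rewrite exprMn; congr (0 <= _); ring.
have -> : (x + 1) - (1 - 2 * c) - (x + 1 + 1) * ((x + c) / (x + 1)) ^+ 2 =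
  ((x + 2 * c) * (x + 1) ^+ 2 - (x + 2) * (x + c) ^+ 2) / (x + 1) ^+ 2.
  by field; rewrite gt_eqF.
rewrite divr_ge0 ?sqr_ge0 //.
have -> : (x + 2 * c) * (x + 1) ^+ 2 - (x + 2) * (x + c) ^+ 2 =
   x * (1 - c ^+ 2) + 2 * c * (1 - c) by ring.
by rewrite addr_ge0 // mulr_ge0 //; nra.
Qed.

Section SquareSummable.
Context {R : realType}.
Implicit Types s a b : nat -> R.

Lemma summable_tail s C : (forall k, 0 <= s k) ->
  (forall n, \sum_(0 <= k < n) s k <= C) ->
  forall d, 0 < d -> exists N, forall n, \sum_(N <= k < n) s k <= d.
Proof.
move=> s_ge0 sC d d_gt0.
pose E := range (fun n => \sum_(0 <= k < n) s k).
have supE : has_sup E.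
  by split; [exists (\sum_(0 <= k < 0) s k), 0%N | exists C => _ [n _ <-]].
have [_ [N _ <-] ltN] := sup_adherent d_gt0 supE.
exists N => n; have [le_nN|/ltnW le_Nn] := leqP n N.
  by rewrite big_geq // ltW.
have : \sum_(0 <= k < n) s k <= sup E.
  by apply: ub_le_sup; [exact: supE.2|exists n].
by rewrite (big_cat_nat (leq0n N) le_Nn) /=; lra.
Qed.

(** For large [n] one of [i] and [n - i] is large for every [i]. So each product
    is, by the inequality [x y <= x^2/(2 l) + l y^2/2], at most [1/(2 l)]
    times a square in a tail plus a small multiple [l/2] of a square of the
    other sequence. *)
Lemma conv_square_summable_cvg0 a b C :
  (forall n, \sum_(0 <= k < n) a k ^+ 2 <= C) ->
  (forall n, \sum_(0 <= k < n) b k ^+ 2 <= C) ->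
  forall d, 0 < d -> exists N, forall n, (N <= n)%N ->
    \sum_(0 <= i < n.+1) a i * b (n - i)%N <= d.
Proof.
move=> aC bC d d_gt0.
have C_ge0 : 0 <= C by have := aC 0%N; rewrite big_nil.
(* Chosen so that the tails contribute [d/2] and the rest [l * C < d/2]. *)
pose l := d / 2 / (C + 1).
have l_gt0 : 0 < l by rewrite !divr_gt0 //; lra.
have dl_gt0 : 0 < d / 2 * l by rewrite mulr_gt0 //; lra.
have [Na aN] := summable_tail (fun k => sqr_ge0 (a k)) aC dl_gt0.
have [Nb bN] := summable_tail (fun k => sqr_ge0 (b k)) bC dl_gt0.
exists (Na + Nb)%N => n le_Nn.
pose tail N s k := if (N <= k)%N then s k ^+ 2 else 0 : R.
have tail_ge0 N s k : 0 <= tail N s k.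
  by rewrite /tail; case: ifP => // _; apply: sqr_ge0.
have tail_sum N s : (N <= n.+1)%N ->
    \sum_(0 <= k < n.+1) tail N s k = \sum_(N <= k < n.+1) s k ^+ 2.
  move=> le_N; rewrite (big_cat_nat (leq0n N) le_N) /= big_nat big1 ?add0r.
    by apply: eq_big_nat => k /andP[le_Nk _]; rewrite /tail le_Nk.
  by move=> k /andP[_ lt_kN]; rewrite /tail leqNgt lt_kN.
have rev (h : nat -> R) :
    \sum_(0 <= i < n.+1) h (n - i)%N = \sum_(0 <= i < n.+1) h i.
  rewrite [RHS]big_nat_rev; apply: eq_big_nat => i _.
  by rewrite add0n subSS.
have amgm x y : x * y <= x ^+ 2 / (2 * l) + l / 2 * y ^+ 2.
  rewrite -subr_ge0.
  have -> : x ^+ 2 / (2 * l) + l / 2 * y ^+ 2 - x * y =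
      (x - l * y) ^+ 2 / (2 * l).
    by field; rewrite gt_eqF.
  by rewrite divr_ge0 ?sqr_ge0 // mulr_ge0 // ltW.
apply: (@le_trans _ _ (\sum_(0 <= i < n.+1)
   ((tail Na a i + tail Nb b (n - i)%N) / (2 * l) +
    l / 2 * (a i ^+ 2 + b (n - i)%N ^+ 2)))).
  rewrite big_nat [leRHS]big_nat; apply: ler_sum => i /andP[_ le_in].
  have l2 : 0 <= (2 * l)^-1 by rewrite invr_ge0 mulr_ge0 // ltW.
  have l3 : 0 <= l / 2 by rewrite divr_ge0 // ltW.
  have ta := mulr_ge0 (tail_ge0 Na a i) l2.
  have tb := mulr_ge0 (tail_ge0 Nb b (n - i)%N) l2.
  have la := mulr_ge0 l3 (sqr_ge0 (a i)).
  have lb := mulr_ge0 l3 (sqr_ge0 (b (n - i)%N)).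
  rewrite mulrDl mulrDr; have [le_Nai|lt_iNa] := leqP Na i.
    have := amgm (a i) (b (n - i)%N).
    have -> : tail Na a i = a i ^+ 2 by rewrite /tail le_Nai.
    lra.
  have le_Nb : (Nb <= n - i)%N.
    by rewrite leq_subRL // (leq_trans _ le_Nn) // leq_add2r ltnW.
  have := amgm (b (n - i)%N) (a i).
  have -> : tail Nb b (n - i)%N = b (n - i)%N ^+ 2 by rewrite /tail le_Nb.
  by rewrite mulrC; lra.
rewrite big_split -mulr_suml -mulr_sumr /= !big_split /=.
rewrite (rev (tail Nb b)) (rev (fun k => b k ^+ 2)) !tail_sum; first last.
- by rewrite (leq_trans (leq_addr Nb Na)) // ltnW.
- by rewrite (leq_trans (leq_addl Na Nb)) // ltnW.
apply: (@le_trans _ _ ((d / 2 * l + d / 2 * l) / (2 * l) + l / 2 * (C + C))).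
  apply: lerD.
    by apply: ler_wpM2r; [rewrite invr_ge0 mulr_ge0 // ltW|apply: lerD].
  by apply: ler_wpM2l; [rewrite divr_ge0 // ltW|apply: lerD].
have -> : (d / 2 * l + d / 2 * l) / (2 * l) + l / 2 * (C + C) =
    d / 2 + l * C.
  by field; rewrite gt_eqF.
have : l * (C + 1) = d / 2 by rewrite /l mulfVK // gt_eqF //; lra.
by rewrite mulrDr mulr1; lra.
Qed.

End SquareSummable.

(** * Power series dominated by a geometric series *)

Lemma geometric_small (R : realType) (p C e : R) : 0 < p -> p < 1 -> 0 < e ->
  exists N, forall n, (N <= n)%N -> C * p ^+ n / (1 - p) <= e.
Proof.
move=> p_gt0 p_lt1 e_gt0.
have : (fun n => C / (1 - p) * p ^+ n) @ \oo --> C / (1 - p) * 0.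
  by apply: cvgMr; apply: cvg_expr; rewrite ger0_norm // ltW.
rewrite mulr0 => /cvgrPdist_le /(_ e e_gt0)[N _ NE]; exists N => n /NE.
by rewrite /= sub0r normrN mulrAC; apply: le_trans; apply: ler_norm.
Qed.

Lemma geometric_tail (R : realType) (V : completeNormedModType R[i])
    (b : nat -> V) (C p : R) :
  0 < p -> p < 1 -> (forall k, rnorm (b k) <= C * p ^+ k) ->
  forall n, rnorm (limn (series b) - \sum_(0 <= k < n) b k) <=
    C * p ^+ n / (1 - p).
Proof.
move=> p_gt0 p_lt1 bC.
have C_ge0 : 0 <= C.
  by have := bC 0%N; rewrite mulr1; apply: le_trans; exact: rnorm_ge0.
have p1 : 0 < 1 - p by lra.
have bound m n : rnorm (\sum_(m <= k < n) b k) <= C * p ^+ m / (1 - p).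
  have pos j : 0 <= C * p ^+ j / (1 - p).
    by rewrite divr_ge0 ?mulr_ge0 ?exprn_ge0 // ltW.
  have [le_nm|/ltnW le_mn] := leqP n m; first by rewrite big_geq ?rnorm0.
  suff : rnorm (\sum_(m <= k < n) b k) <=
      C * p ^+ m / (1 - p) - C * p ^+ n / (1 - p).
    by have := pos n; lra.
  elim: n le_mn => [|n IHn].
    by rewrite leqn0 => /eqP ->; rewrite big_geq ?rnorm0 // subrr.
  rewrite leq_eqVlt => /predU1P[<-|le_mn].
    by rewrite big_geq ?rnorm0 // subrr.
  rewrite big_nat_recr //=; apply: (le_trans (ler_rnormD _ _)).
  apply: (le_trans (lerD (IHn le_mn) (bC n))).
  rewrite exprS le_eqVlt; apply/orP; left; apply/eqP; field.
  by rewrite gt_eqF.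
have cb : cvgn (series b).
  apply/cauchy_cvgP/cauchy_seriesP => e e_gt0.
  have eE : e = (complex.Re e)%:C by rewrite RRe_real // gtr0_real.
  have e2 : 0 < complex.Re e / 2 by rewrite divr_gt0 // -ltcR -eE.
  have [N NE] := geometric_small C p_gt0 p_lt1 e2.
  exists ([set n | (N <= n)%N], [set: nat]).
    by split; [exists N|exact: filterT].
  move=> [m n] /= [/NE le_m _]; rewrite eE rnormE ltcR.
  by apply: (le_lt_trans (bound _ _)); apply: (le_lt_trans le_m); lra.
move=> n; apply/ler_addgt0Pr => e e_gt0.
have [N NE] := cvg_rnorm cb e_gt0.
have := NE (maxn N n) (leq_maxl _ _).
rewrite /series /= (big_cat_nat (leq0n n) (leq_maxr N n)) /=.
set S := \sum_(0 <= k < n) b k; set T := \sum_(n <= k < _) b k => le_e.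
rewrite (_ : _ - S = (limn (series b) - (S + T)) + T); last first.
  by rewrite opprD addrA subrK.
apply: (le_trans (ler_rnormD _ _)); rewrite [leRHS]addrC.
by apply: lerD; [exact: le_e|exact: bound].
Qed.

(** * Boundedness near the unit circle *)

(** The annulus lies in the image of a compact part [K] of the square
    [[-2, 2] x [-2, 2]] of the real plane, and [F] is continuous on that
    image. *)
Lemma bounded_annulus (R : realType) (V : normedModType R[i])
    (F : R[i]^o -> V) :
  {within [set z : R[i]^o | 1 <= `|z|], continuous F} ->
  exists M : R, forall z : R[i],
    1 <= rnorm (z : R[i]^o) <= 2 -> rnorm (F z) <= M.
Proof.
move=> cF.
pose h (p : R * R) : R[i]^o := p.1%:C + ('i%C : R[i]) *: (p.2%:C : R[i]^o).
have hE p : h p = (p.1 +i* p.2)%C by rewrite /h [RHS]complexE.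
have ch : continuous h.
  move=> p; apply: cvgD.
    apply: (@continuous_comp _ _ _ fst); first exact: cvg_fst.
    exact: real_complex_continuous.
  apply: cvgZr; apply: (@continuous_comp _ _ _ snd); first exact: cvg_snd.
  exact: real_complex_continuous.
pose K := (`[(-2 : R), 2] `*` `[(-2 : R), 2]) `&` [set p | 1 <= rnorm (h p)].
have cK : compact K.
  apply: compact_closedI; first by apply: compact_setX; exact: segment_compact.
  apply: (@preimage_closed _ _ (fun p => rnorm (h p)) [set t | 1 <= t]).
    by move=> p _; apply: continuous_comp; [exact: ch|exact: rnorm_continuous].
  exact: closed_ge.
have chK : compact (h @` K).
  by apply: continuous_compact => //; apply: continuous_subspaceT.
have sub : h @` K `<=` [set z : R[i]^o | 1 <= `|z|].
  by move=> _ [p [_ /= p1] <-]; rewrite /= rnormE (lecR 1).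
have cFK : {within h @` K, continuous (fun z => rnorm (F z))}.
  have cF' := continuous_subspaceW sub cF.
  move=> z; apply: continuous_comp; [exact: cF'|exact: rnorm_continuous].
have mem z : 1 <= rnorm (z : R[i]^o) <= 2 -> (h @` K) z.
  move=> /andP[z1 z2]; exists (complex.Re z, complex.Im z); last first.
    by rewrite hE; case: z {z1 z2}.
  have Ez : (rnorm (z : R[i]^o)) ^+ 2 = complex.Re z ^+ 2 + complex.Im z ^+ 2.
    by apply: complexI; rewrite add_Re2_Im2 rmorphXn /= -(rnormE (z : R[i]^o)).
  split; last by rewrite /= hE; case: z z1 {z2 Ez}.
  have ge0 := rnorm_ge0 (z : R[i]^o).
  split; rewrite /= in_itv /=; nra.
have ne : h @` K !=set0.
  by exists (1 : R[i]); apply: mem; rewrite cnorm1; lra.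
have [c _ cmax] := compact_EVT_max ne chK cFK.
by exists (rnorm (F c)) => z /mem Kz; apply: cmax; rewrite inE.
Qed.

(** * Causal sequences and weighted square summability *)

Section Causal.
Context {R : realType} {H : completeNormedModType R[i]}.
Implicit Types (u : int -> H) (x : H).

Lemma spt_eq0 u (m n : int) : spt u `<=` [set k | m <= k] -> n < m -> u n = 0.
Proof.
move=> um lt_nm; apply/eqP/negP => /negP un0.
by have /(_ un0) := um n; rewrite /= leNgt lt_nm.
Qed.

Lemma fdiff_causal (a : R[i]) u (m : int) (n : nat) :
  spt u `<=` [set k | m <= k] ->
  fdiff a u (m + n%:Z) = conv (pow1B a) (fun k : nat => u (m + k%:Z)) n.
Proof.
move=> um; rewrite /fdiff; apply: lim_near_cst; first exact: norm_hausdorff.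
exists n.+1 => // N /= lt_nN.
rewrite /series /= (big_cat_nat (leq0n n.+1) lt_nN) /=.
rewrite [X in _ + X]big_nat [X in _ + X]big1 ?addr0.
  by apply: eq_big_nat => i /andP[_ le_in]; rewrite -addrA -subzn.
move=> i /andP[lt_ni _]; rewrite (spt_eq0 um) ?scaler0 //.
by rewrite -addrA gtrDl subr_lt0 ltz_nat.
Qed.

Lemma fdiff_nat (a : R[i]) u (n : nat) : spt u `<=` [set k | 0 <= k] ->
  fdiff a u n%:Z = conv (pow1B a) (fun k : nat => u k%:Z) n.
Proof.
move=> u0; rewrite -[n%:Z]add0r (fdiff_causal _ _ u0).
by congr conv; apply/funext => k; rewrite add0r.
Qed.

Lemma ztransform_nonneg u (z : R[i]) :
  spt u `<=` [set n | 0 <= n] ->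
  ztransform u z^-1 = limn (series (fun k : nat => z ^+ k *: u k%:Z)).
Proof.
move=> u0; rewrite /ztransform [X in _ + X](_ : _ = 0) ?addr0.
  suff -> : (fun k : nat => z^-1 ^ (- Posz k) *: u (Posz k)) =
            (fun k : nat => z ^+ k *: u k%:Z) by [].
  by apply/funext => k; rewrite exprz_inv opprK.
apply: lim_near_cst; first exact: norm_hausdorff.
near=> N; rewrite /series /= big1 // => k _.
by rewrite (spt_eq0 u0) // scaler0.
Unshelve. all: by end_near. Qed.

Lemma l2_growth rho u : 0 < rho -> l2 rho u ->
  exists C, forall k : nat, rnorm (u k%:Z) <= C * rho ^+ k.
Proof.
move=> rho_gt0 lu.
pose C := fine (l2sq rho u).
have term_ge0 (k : int) : 0 <= rnorm (u k) ^+ 2 * rho ^ (- (2 * k)).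
  by rewrite mulr_ge0 ?sqr_ge0 // exprz_ge0 // ltW.
have fin : l2sq rho u \is a fin_num.
  by rewrite ge0_fin_numE //; apply: esum_ge0 => k _; rewrite lee_fin.
exists (C + 1) => k.
have : ((rnorm (u k%:Z) ^+ 2 * rho ^ (- (2 * k%:Z)))%:E <= l2sq rho u)%E.
  apply: esum_ge; exists [set k%:Z]; first by split; [exact: finite_set1|].
  by rewrite fsbig_set1.
rewrite -(fineK fin) lee_fin -/C.
rewrite (_ : rho ^ (- (2 * k%:Z)) = ((rho ^+ k)^-1) ^+ 2); last first.
  by rewrite mulrC -[2]/(2%N%:Z) -PoszM -exprnN exprM exprVn.
rewrite -exprMn -ler_pdivrMr ?exprn_gt0 //.
have := rnorm_ge0 (u k); set y := rnorm _ / _ => _ yC.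
have [y_le0|y_gt0] := leP y 0; first by have := sqr_ge0 y; lra.
nra.
Qed.

Lemma l2_delta rho (n : int) x : 0 < rho -> l2 rho (delta n x).
Proof.
move=> rho_gt0; rewrite /l2 /= /l2sq.
set a := fun k : int => (rnorm (delta n x k) ^+ 2 * rho ^ (- (2 * k)))%:E.
have -> : (\esum_(k in [set: int]) a k = \esum_(k in [set n]) a k)%E.
  rewrite [RHS]esum_mkcond; apply: eq_esum => k _.
  case: ifPn => //; rewrite notin_setE /= => /eqP nk.
  by rewrite /a /delta (negPf nk) rnorm0 expr0n mul0r.
rewrite esum_fset; last 2 first.
- exact: finite_set1.
- by move=> k _; rewrite lee_fin mulr_ge0 ?sqr_ge0 // exprz_ge0 // ltW.
by rewrite fsbig_set1 ltry.
Qed.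

Lemma l2invK rho (T : (int -> H) -> int -> H) g :
  l2_invertible rho T -> l2 rho g ->
  l2 rho (l2inv rho T g) /\ T (l2inv rho T g) = g.
Proof.
move=> [bij _] lg; have surj := set_bij_surj bij; split.
  by apply: (surjpinv_image_sub surj); exists g.
by apply: pinvK; rewrite inE; exact: surj.
Qed.

End Causal.

(** * The Riemann-Liouville and Caputo recurrences *)

Section Recurrences.
Context {R : realType} {H : completeNormedModType R[i]}.
Context (a : R[i]) (A : {linear H -> H}).

Lemma RL_recurrence x (u : int -> H) : spt u `<=` [set n | 0 <= n] ->
  RL_solution a A x u ->
  let v k := u k%:Z in
  conv (pow1B a) v 0 = x /\ forall n, conv (pow1B a) v n.+1 = A (v n).
Proof.
move=> u0 eq_u v.
split=> [|n]; rewrite -(fdiff_nat _ _ u0).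
  have := congr1 (fun s => s (-1)) eq_u.
  by rewrite /tau /= addNr (spt_eq0 u0) // linear0 add0r /delta eqxx.
have := congr1 (fun s => s n%:Z) eq_u.
by rewrite /tau /= /delta addr0 -[n%:Z + 1]/(n%:Z + 1%N%:Z) -PoszD addn1.
Qed.

(** The forcing term is [(1 - w)^a (1 - w)^(-1) = (1 - w)^(a - 1)] in terms of
    coefficients, because [chi_ge] is constant on its support. *)
Lemma Caputo_recurrence x (u : int -> H) : spt u `<=` [set n | 0 <= n] ->
  Caputo_solution a A x u ->
  let v k := u k%:Z in
  conv (pow1B a) v 0 = x /\
  forall n, conv (pow1B a) v n.+1 = A (v n) + pow1B (a - 1) n.+1 *: x.
Proof.
move=> u0 eq_u v.
have chi (n : nat) : fdiff a (chi_ge (-1) x) (-1 + n%:Z) = pow1B (a - 1) n *: x.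
  rewrite fdiff_causal => [|k]; last first.
    by rewrite /spt /chi_ge /=; case: ifP => //; rewrite eqxx.
  rewrite -pow1BD /conv scaler_suml; apply: eq_bigr => i _.
  by rewrite /chi_ge lerDl pow1BN1 [_ *: 1]mulr1.
split=> [|n]; rewrite -(fdiff_nat _ _ u0).
  have := congr1 (fun s => s (-1)) eq_u.
  rewrite /tau /= addNr (spt_eq0 u0) // linear0 add0r.
  by rewrite -[-1 in RHS]addr0 chi pow1B0 scale1r.
have := congr1 (fun s => s n%:Z) eq_u.
rewrite /tau /= -[n%:Z + 1]/(n%:Z + 1%N%:Z) -PoszD addn1 => ->.
by rewrite -chi; congr (_ + fdiff _ _ _); lia.
Qed.

(** [(1 - w)^(a - 1)] applied to the Riemann-Liouville solution satisfies the
    Caputo recurrence: it commutes with [(1 - w)^a], and the initial value [x]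
    of the former produces exactly the forcing term of the latter. *)
Lemma Caputo_eq_conv x (u v : nat -> H) :
  conv (pow1B a) v 0 = x -> (forall n, conv (pow1B a) v n.+1 = A (v n)) ->
  conv (pow1B a) u 0 = x ->
  (forall n, conv (pow1B a) u n.+1 = A (u n) + pow1B (a - 1) n.+1 *: x) ->
  u = conv (pow1B (a - 1)) v.
Proof.
move=> v0 vS u0 uS.
have comm : conv (pow1B a) (conv (pow1B (a - 1)) v) =
    conv (pow1B (a - 1)) (conv (pow1B a) v).
  by rewrite !conv_assoc convC.
apply: (conv_recurrence_uniq (A := A) (pow1B0 a)); rewrite comm.
  by rewrite u0 /conv big_nat1 pow1B0 scale1r.
move=> n; rewrite uS addrC addKr.
rewrite {1}/conv big_nat_recr //= subnn v0 addrC.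
rewrite (_ : \sum_(0 <= i < n.+1) _ = A (conv (pow1B (a - 1)) v n)) ?addrK //.
rewrite /conv linear_sum; apply: eq_big_nat => i /andP[_ le_in].
by rewrite linearZ /= subSn // -vS.
Qed.

Context (Hinv : forall rho : R, 1 < rho ->
  l2_invertible rho (frac_op a A) /\ causal rho (l2inv rho (frac_op a A))).

(** Causality gives support in the indices [n >= -1]; the equation at index
    [-2] then forces the value at [-1] to vanish. *)
Lemma RL_fundamental (rho : R) x : 1 < rho ->
  let u := l2inv rho (frac_op a A) (delta (-1) x) in
  [/\ l2 rho u, spt u `<=` [set n | 0 <= n] & RL_solution a A x u].
Proof.
move=> rho1 u.
have rho0 : 0 < rho by rewrite (lt_trans ltr01).
have [inv caus] := Hinv rho1.
have ld := l2_delta (-1) x rho0.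
have [lu eq_u] := l2invK inv ld.
have sol : RL_solution a A x u.
  apply/funext => n; have := congr1 (fun s => s n) eq_u.
  by rewrite /frac_op -/u => <-; rewrite addrC subrK.
have u1 : spt u `<=` [set n | -1 <= n].
  apply: caus => // n; rewrite /spt /delta /=.
  by case: (n =P -1) => [->|]; rewrite ?eqxx.
split=> // n; rewrite /spt /= => /eqP un; rewrite leNgt; apply/negP => n0.
apply: un.
have [->|n1] := eqVneq n (-1); last first.
  by apply: (spt_eq0 u1); rewrite lt_neqAle n1; lia.
have := congr1 (fun s => s (-2)) sol.
rewrite /tau /delta /= (spt_eq0 u1) // linear0 addr0.
rewrite (_ : -2 + 1 = -1 + 0%N%:Z) // (fdiff_causal _ _ u1) /conv big_nat1.
by rewrite pow1B0 scale1r.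
Qed.

(** By uniqueness, [u] coincides on [n >= 0] with the solution that inverting
    the operator provides in every weighted space. This yields the growth
    bounds for [multiplier_bound], and for the weight [rho0] the link between
    [u] and the function with a continuous extension. *)
Lemma RL_multiplier (f : H -> H -> R[i]) (rho0 : R) x (u : int -> H) :
  (forall y, scalar (f^~ y)) ->
  (forall x, linear_for (Num.conj \; *%R) (f x)) ->
  (forall x, `|x| ^+ 2 = f x x) ->
  1 < rho0 ->
  continuation_to_circle
    (ztransform (l2inv rho0 (frac_op a A) (delta (-1) x))) ->
  spt u `<=` [set n | 0 <= n] -> RL_solution a A x u ->
  exists M, forall (g : nat -> R[i]) K,
    \sum_(0 <= k < K) rnorm (conv g (fun k => u k%:Z) k) ^+ 2 <=
    M ^+ 2 * \sum_(0 <= k < K) rnorm (g k : R[i]^o) ^+ 2.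
Proof.
move=> fl fr fE rho0_gt1 [F [cF FE]] u0 eq_u; set v := fun k => u k%:Z.
have same rho : 1 < rho ->
    (fun k : nat => l2inv rho (frac_op a A) (delta (-1) x) k%:Z) = v.
  move=> /(@RL_fundamental _ x)[_ w0 eq_w].
  have [v0 vS] := RL_recurrence u0 eq_u.
  have [w0' wS] := RL_recurrence w0 eq_w.
  apply: (conv_recurrence_uniq (A := A) (pow1B0 a)); first by rewrite v0 w0'.
  by move=> n; rewrite vS wS !subrr.
have growth rho : 1 < rho -> exists C, forall k, rnorm (v k) <= C * rho ^+ k.
  move=> rho1; have [lw _ _] := RL_fundamental x rho1.
  rewrite -(same rho rho1).
  by apply: (l2_growth _ lw); apply: lt_trans rho1.
have [M FM] := bounded_annulus cF.
exists M => g K.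
apply: (multiplier_bound
  (F := fun z => limn (series (fun k => z ^+ k *: v k))) g K fl fr fE).
- move=> q eps q_gt0 q_lt1 eps_gt0.
  (* Any weight strictly between [1] and [1/q] makes the series geometric. *)
  pose rho := (1 + q^-1) / 2.
  have q1 : 1 < q^-1 by rewrite invf_gt1.
  have rho1 : 1 < rho by rewrite /rho; lra.
  have [C vC] := growth rho rho1.
  pose p := q * rho.
  have pE : p = (q + 1) / 2 by rewrite /p /rho; field; rewrite gt_eqF.
  have p_gt0 : 0 < p by rewrite pE; lra.
  have p_lt1 : p < 1 by rewrite pE; lra.
  have [n0 small] := geometric_small C p_gt0 p_lt1 eps_gt0.
  exists n0 => n /small le_eps z zq; apply: le_trans le_eps.
  apply: geometric_tail => // k.
  rewrite rnormZ cnormX zq /p exprMn mulrCA ler_wpM2l ?vC //.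
  by rewrite exprn_ge0 // ltW.
- move=> z /andP[z_ge z_lt].
  have z_gt0 : 0 < rnorm (z : R[i]^o).
    by apply: lt_le_trans z_ge; rewrite invr_gt0.
  have z0 : z != 0 by apply: contraTneq z_gt0 => ->; rewrite rnorm0 ltxx.
  have zV : rnorm (z^-1 : R[i]^o) = (rnorm (z : R[i]^o))^-1.
    apply: (mulfI (lt0r_neq0 z_gt0)).
    by rewrite -cnormM !mulfV ?cnorm1 // gt_eqF.
  have := FE z^-1; have [_ w0 _] := RL_fundamental x rho0_gt1.
  rewrite -(same _ rho0_gt1) (ztransform_nonneg _ w0) /= => <-.
    apply: FM; rewrite zV ltW ?invf_gt1 //=.
    by rewrite -[2]invrK lef_pV2 // posrE invr_gt0.
  by rewrite (rnormE (z^-1 : R[i]^o)) zV (ltcR 1) invf_gt1.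
Qed.

End Recurrences.

(** * Asymptotic stability *)

Unset Implicit Arguments.

Theorem proposition4p11 (R : realType) (H : completeNormedModType R[i])
    (dot : {dot H for @Num.conj R[i]}) (Hdot : hilbert_norm dot)
    (Hsep : separable H)
    (alpha : R) (alpha_gt0 : 0 < alpha) (alpha_lt1 : alpha < 1)
    (A : {linear H -> H}) (A_bounded : bounded_op A)
    (Hinv : forall rho : R, 1 < rho ->
       l2_invertible rho (frac_op alpha%:C A) /\
       causal rho (l2inv rho (frac_op alpha%:C A)))
    (rho0 : R) (rho0_gt1 : 1 < rho0)
    (Hcont : forall x : H, continuation_to_circle
       (ztransform (l2inv rho0 (frac_op alpha%:C A) (delta (-1) x)))) :
  asymptotically_stable (RL_solution alpha%:C A) /\
  asymptotically_stable (Caputo_solution alpha%:C A).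
Proof.
have dl y : scalar (dot^~ y) by move=> c u v; exact: linearPl.
have dr u : linear_for (Num.conj \; *%R) (dot u).
  by move=> c v w; exact: linearPr.
have mult x u := RL_multiplier Hinv (u := u) dl dr Hdot rho0_gt1 (Hcont x).
split=> rho rho_gt1 x u lu u0 eq_u.
  have [M vM] := mult x u u0 eq_u.
  have vM' n : \sum_(0 <= k < n) rnorm (u k%:Z) ^+ 2 <= M ^+ 2.
    have := vM (fun k => (k == 0)%:R) n; rewrite conv_delta => /le_trans; apply.
    by rewrite ler_piMr ?sqr_ge0 // sum_delta_sq.
  apply: rnorm_cvg => e e_gt0.
  have [N NE] := summable_tail (fun k => sqr_ge0 (rnorm (u k%:Z))) vM'
    (exprn_gt0 2 e_gt0).
  exists N => n le_Nn; rewrite sub0r rnormN.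
  rewrite -(ler_pXn2r (ltn0Sn 1)) ?nnegrE ?rnorm_ge0 ?(ltW e_gt0) //.
  apply: le_trans (NE n.+1); rewrite big_nat_recr //= lerDr sumr_ge0 // => k _.
  exact: sqr_ge0.
pose w := l2inv rho0 (frac_op alpha%:C A) (delta (-1) x).
have [_ w0 eq_w] := RL_fundamental Hinv x rho0_gt1.
have [M wM] := mult x w w0 eq_w.
have [v0 vS] := RL_recurrence w0 eq_w.
have [u0' uS] := Caputo_recurrence u0 eq_u.
have uE := Caputo_eq_conv v0 vS u0' uS.
set v : nat -> H := fun k => w k%:Z in wM v0 vS uE.
pose c := (1 - alpha) / 2.
pose e := pow1B (- c)%:C : nat -> R[i].
have eE : pow1B (alpha%:C - 1) = conv (V := R[i]^o) e e.
  rewrite pow1BD -rmorphD -(rmorph1 (real_complex R)) -rmorphB.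
  congr (pow1B _%:C).
  by rewrite /c; field.
pose y := conv e v.
rewrite eE -conv_assoc -/y in uE.
have eC n : \sum_(0 <= k < n) rnorm (e k : R[i]^o) ^+ 2 <= alpha^-1.
  have c_gt0 : 0 < c by rewrite /c; lra.
  have c_lt : c < 2^-1 by rewrite /c; lra.
  have := pow1B_square_sum n c_gt0 c_lt.
  have -> : 1 - 2 * c = alpha by rewrite /c; field.
  rewrite -[alpha^-1]mul1r ler_pdivlMr // [X in _ -> X <= _]mulrC.
  by move/le_trans; apply; rewrite gerBl mulr_ge0 ?sqr_ge0.
pose C := Num.max alpha^-1 (M ^+ 2 * alpha^-1).
have yC n : \sum_(0 <= k < n) rnorm (y k) ^+ 2 <= C.
  apply: (le_trans (wM e n)); rewrite /C le_max; apply/orP; right.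
  by rewrite ler_wpM2l ?sqr_ge0.
have eC' n : \sum_(0 <= k < n) rnorm (e k : R[i]^o) ^+ 2 <= C.
  by rewrite /C le_max eC.
apply: rnorm_cvg => d d_gt0.
have [N NE] := conv_square_summable_cvg0 eC' yC d_gt0.
exists N => n /NE; rewrite sub0r rnormN; apply: le_trans.
rewrite (congr1 (fun s => s n) uE) /conv; apply: (le_trans (ler_rnorm_sum _ _)).
by apply: ler_sum => i _; rewrite rnormZ.
Qed.
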